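(* Let $G=(V,E)$ be a connected, locally finite infinite network with conductance function $c$ and base point $o\in V$, let $\Delta=\Delta^{(c)}$ be the corresponding Laplace operator, and let $\mathscr{H}$ be the energy Hilbert space (the RKHS of $k^{(c)}(x,y)=\langle v_x,v_y\rangle_{\mathscr{H}}$). Then for all $x\in V\setminus\{o\}$, $$\langle\delta_x,f\rangle_{\mathscr{H}}=(\Delta f)(x)\quad\text{for all } f\in\mathscr{H},$$ and $$\delta_x=c(x)\,v_x-\sum_{y\sim x}c_{xy}\,v_y.$$
   Context: Setting. $V$ is a countably infinite set, $E\subset V\times V\setminus(\text{diagonal})$ is symmetric, and $c:E\to(0,\infty)$ satisfies $c_{xy}=c_{yx}$. Write $y\sim x$ if $(x,y)\in E$. Each $x\in V$ has only finitely many neighbors. A base point $o\in V$ is fixed, and $G$ is connected: for every $x\in V\setminus\{o\}$ there are edges $(x_i,x_{i+1})\in E$, $0\le i\le n-1$, with $x_0=o$, $x_n=x$. Put $c(x)=\sum_{y\sim x}c_{xy}$ and $(\Delta f)(x)=\sum_{y\sim x}c_{xy}(f(x)-f(y))$. The energy Hilbert space $\mathscr{H}$ consists of all functions $f:V\to\mathbb{C}$ with $f(o)=0$ and $\|f\|_{\mathscr{H}}^2=\frac12\sum_{(x,y)\in E}c_{xy}|f(x)-f(y)|^2<\infty$, with inner product $\langle h,f\rangle_{\mathscr{H}}=\frac12\sum_{(x,y)\in E}c_{xy}(\overline{h(x)}-\overline{h(y)})(f(x)-f(y))$. For each $x\in V$ the dipole $v_x\in\mathscr{H}$ is the unique vector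 with $\langle v_x,f\rangle_{\mathscr{H}}=f(x)-f(o)$ for all $f\in\mathscr{H}$ (so $v_o=0$). $\delta_x$ is the function on $V$ equal to $1$ at $x$ and $0$ elsewhere. *)

(* Defs.v *)
From HB Require Import structures.
From mathcomp Require Import all_boot all_order all_algebra.
From mathcomp Require Import all_classical all_reals all_analysis.
From mathcomp Require Export complex.

Set Implicit Arguments.
Unset Strict Implicit.
Unset Printing Implicit Defensive.

Import Order.TTheory GRing.Theory Num.Theory.
Import Normc.

Local Open Scope classical_set_scope.
Local Open Scope ring_scope.
Local Open Scope complex_scope.

Record network (R : realType) (V : countType) := Network {
  edge : rel V;
  edge_sym : symmetric edge;
  edge_irr : irreflexive edge;
  (* only the values on edges are constrained, and only these are ever used *)
  cond : V -> V -> R;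
  cond_gt0 : forall x y, edge x y -> 0 < cond x y;
  cond_sym : forall x y, edge x y -> cond x y = cond y x;
  base : V;
  network_infinite : infinite_set [set: V];
  locally_finite : forall x, finite_set [set y | edge x y];
  network_connected : forall x, x != base ->
    exists2 p : seq V, path edge base p & last base p = x }.

Section Summation.
Variables (R : realType) (I : choiceType).

(* Unordered sums of absolutely summable families. *)
Definition rsum (D : set I) (a : I -> R) : R :=
  fine (\esum_(i in D) (EFin \o a)^\+ i - \esum_(i in D) (EFin \o a)^\- i)%E.

Definition csum (D : set I) (a : I -> R[i]) : R[i] :=
  rsum D (fun i => complex.Re (a i)) +i* rsum D (fun i => complex.Im (a i)).

End Summation.

Section EnergySpace.
Variables (R : realType) (V : countType) (G : network R V).
Implicit Types (x y : V) (f h v : V -> R[i]).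

Definition neighbors x : set V := [set y | edge G x y].

Definition edges : set (V * V) := [set e | edge G e.1 e.2].

Definition total_cond x : R := \sum_(y \in neighbors x) cond G x y.

Definition laplacian f x : R[i] :=
  \sum_(y \in neighbors x) (cond G x y)%:C * (f x - f y).

Definition energy f : \bar R :=
  (2^-1%:E *
   \esum_(e in edges) (cond G e.1 e.2 * normc (f e.1 - f e.2) ^+ 2)%:E)%E.

Definition energy_space : set (V -> R[i]) :=
  [set f | f (base G) = 0 /\ (energy f < +oo)%E].

(* Antilinear in the first argument.  For h and f of finite energy the family
   is absolutely summable by the Cauchy-Schwarz inequality. *)
Definition energy_inner h f : R[i] :=
  2^-1 * csum edges (fun e => (cond G e.1 e.2)%:C *
    ((h e.1)^* - (h e.2)^*) * (f e.1 - f e.2)).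

Definition is_dipole x v : Prop :=
  energy_space v /\
  forall f, energy_space f -> energy_inner v f = f x - f (base G).

(* The default value is irrelevant: by the Riesz representation theorem
   exactly one function satisfies [is_dipole x]. *)
Definition dipole x : V -> R[i] := xget (fun=> 0) (is_dipole x).

Definition delta x : V -> R[i] := fun y => (y == x)%:R.

End EnergySpace.

(* Main.v *)
Require Import Defs.
From mathcomp Require Import all_boot all_order all_algebra.
From mathcomp Require Import all_classical all_reals all_analysis.
From mathcomp Require Import complex ring lra.

Set Implicit Arguments.
Unset Strict Implicit.
Unset Printing Implicit Defensive.

Import Order.TTheory GRing.Theory Num.Theory.
Import numFieldNormedType.Exports.
Local Open Scope classical_set_scope.
Local Open Scope ring_scope.
Local Open Scope complex_scope.

(** For the first identity, [delta R x] has finite support, so only the finitely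
    many edges at [x] contribute to its inner product with [f].  Each of them
    occurs in both orientations, which cancels the factor 1/2 and leaves the
    Laplacian of [f] at [x].

    For the second identity write [v_z] for the dipole at [z].  The first
    identity with [f = v_z] gives [<delta_x, v_z> = c(x) v_z(x) - sum c_xy v_z(y)].
    By Hermitian symmetry and the reproducing property of [v_z] the left-hand
    side is the conjugate of [delta_x(z) - delta_x(o) = delta_x(z)]; this is
    where [x] must differ from the base point [o].  The reproducing property
    and symmetry also give [v_z(y) = conj (v_y(z))], and conjugating yields the
    claim, evaluated at [z].

    The substantial point is that dipoles exist ([dipole_exists]), which is the
    Riesz representation theorem for evaluations.  It is proved for real
    functions ([dform_riesz]) by minimizing the energy minus a multiple of the
    value at the given point.  Since the network is connected, the energy
    controls every value ([dform_bounds_values]); hence a minimizing sequence,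
    which is Cauchy in energy by the parallelogram identity, converges
    pointwise.  Lower semicontinuity of the energy ([dform_lsc]) makes the limit
    a minimizer, and the first variation at a minimizer is the reproducing
    property.  The complex inner product is then expanded in real and
    imaginary parts ([energy_inner_ReIm]). *)

(** * Unordered sums of real families *)
Section RealSums.
Variables (R : realType) (I : choiceType) (D : set I).
Implicit Types (a b p q : I -> R) (F : set I).

(** Absolute summability on [D], which is the domain on which [rsum] behaves
    as a sum. *)
Definition abs_summable a : Prop := summable D (EFin \o a).

Lemma le_abs_summable a b :
  (forall i, D i -> `|a i| <= b i) -> abs_summable b -> abs_summable a.
Proof.
move=> ab; apply: le_lt_trans; apply: le_esum => i Di /=.
by rewrite lee_fin (le_trans (ab _ Di))// ler_norm.
Qed.

Lemma abs_summableD a b :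
  abs_summable a -> abs_summable b -> abs_summable (fun i => a i + b i).
Proof. exact: summableD. Qed.

Lemma abs_summable_norm a : abs_summable a -> abs_summable (fun i => `|a i|).
Proof.
by apply: le_lt_trans; apply: le_esum => i Di /=; rewrite lee_fin normr_id.
Qed.

Lemma abs_summableZ k a : abs_summable a -> abs_summable (fun i => k * a i).
Proof.
move=> sa; rewrite /abs_summable /summable.
have fa : \esum_(i in D) `|(a i)%:E|%E \is a fin_num.
  by rewrite -(summableE D (EFin \o a)).
apply: (@le_lt_trans _ _ (`|k|%:E * \esum_(i in D) `|(a i)%:E|)%E); last first.
  by rewrite -(fineK fa) -EFinM ltry.
apply: ge_ereal_sup => _ [X [finX XD] <-].
rewrite (eq_fsbigr (fun i => `|k|%:E * `|(a i)%:E|)%E); last first.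
  by move=> i _; rewrite /= normrM.
rewrite -ge0_mule_fsumr//; apply: lee_wpmul2l => //.
by apply: esum_ge; exists X.
Qed.

Let rsum_sub p q :
  (forall i, D i -> 0 <= p i) -> (forall i, D i -> 0 <= q i) ->
  abs_summable p -> abs_summable q ->
  rsum D (fun i => p i - q i) = fine (\esum_(i in D) (p i)%:E) -
                                fine (\esum_(i in D) (q i)%:E).
Proof.
move=> p0 q0 sp sq; rewrite /rsum.
have := @esumB R I D (EFin \o p) (EFin \o q) sp sq.
move=> ->; rewrite ?fineB//=.
- rewrite (eq_esum (b := fun i => `|(p i)%:E|%E)); last first.
    by move=> i Di /=; rewrite ger0_norm ?p0.
  by rewrite -(summableE D (EFin \o p)).
- rewrite (eq_esum (b := fun i => `|(q i)%:E|%E)); last first.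
    by move=> i Di /=; rewrite ger0_norm ?q0.
  by rewrite -(summableE D (EFin \o q)).
Qed.

Lemma eq_rsum a b : (forall i, D i -> a i = b i) -> rsum D a = rsum D b.
Proof.
move=> ab; rewrite /rsum; congr (fine (_ - _)%E); apply: eq_esum => i Di.
  by rewrite !funeposE /= ab.
by rewrite !funenegE /= ab.
Qed.

Lemma EFin_rsum a : (forall i, D i -> 0 <= a i) -> abs_summable a ->
  (rsum D a)%:E = \esum_(i in D) (a i)%:E.
Proof.
move=> a0 sa; have s0 : abs_summable (fun=> 0).
  by apply: le_abs_summable sa => i Di; rewrite normr0 a0.
rewrite (eq_rsum (b := fun i => a i - 0)); last by move=> i; rewrite subr0.
rewrite rsum_sub// [X in _ - fine X]esum1//= subr0 fineK//.
rewrite (eq_esum (b := fun i => `|(a i)%:E|%E)); last first.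
  by move=> i Di /=; rewrite ger0_norm ?a0.
by rewrite -(summableE D (EFin \o a)).
Qed.

Lemma rsum_ge0 a : (forall i, D i -> 0 <= a i) -> abs_summable a ->
  0 <= rsum D a.
Proof.
by move=> a0 sa; rewrite -lee_fin EFin_rsum// esum_ge0// => i Di; rewrite lee_fin a0.
Qed.

Let rsumD_ge0 p q :
  (forall i, D i -> 0 <= p i) -> (forall i, D i -> 0 <= q i) ->
  abs_summable p -> abs_summable q ->
  rsum D (fun i => p i + q i) = rsum D p + rsum D q.
Proof.
move=> p0 q0 sp sq; apply: EFin_inj; rewrite EFinD !EFin_rsum//.
- by rewrite -esumD// => i Di; rewrite lee_fin ?p0 ?q0.
- by move=> i Di; rewrite addr_ge0 ?p0 ?q0.
- exact: abs_summableD.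
Qed.

Let rsumB_ge0 p q :
  (forall i, D i -> 0 <= p i) -> (forall i, D i -> 0 <= q i) ->
  abs_summable p -> abs_summable q ->
  rsum D (fun i => p i - q i) = rsum D p - rsum D q.
Proof. by move=> p0 q0 sp sq; rewrite rsum_sub// -!EFin_rsum. Qed.

(* Positive and negative parts reduce linearity of [rsum] to nonnegative
   families, where [rsum] is a supremum of finite partial sums. *)
Let pos a : I -> R := fun i => (`|a i| + a i) / 2.
Let neg a : I -> R := fun i => (`|a i| - a i) / 2.
Let pos_ge0 a i : D i -> 0 <= pos a i.
Proof. by move=> _; rewrite /pos; have := ler_norm (- a i); rewrite normrN; lra. Qed.
Let neg_ge0 a i : D i -> 0 <= neg a i.
Proof. by move=> _; rewrite /neg; have := ler_norm (a i); lra. Qed.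
Let posnegE a i : a i = pos a i - neg a i.
Proof. by rewrite /pos /neg; field. Qed.
Let summable_pos a : abs_summable a -> abs_summable (pos a).
Proof.
move/abs_summable_norm; apply: le_abs_summable => i Di.
by rewrite ger0_norm ?pos_ge0// /pos; have := ler_norm (a i); lra.
Qed.
Let summable_neg a : abs_summable a -> abs_summable (neg a).
Proof.
move/abs_summable_norm; apply: le_abs_summable => i Di.
rewrite ger0_norm ?neg_ge0// /neg; have := ler_norm (- a i).
by rewrite normrN; lra.
Qed.
Let rsumE a : abs_summable a -> rsum D a = rsum D (pos a) - rsum D (neg a).
Proof.
move=> sa; rewrite -(rsumB_ge0 (@pos_ge0 a) (@neg_ge0 a)) ?(eq_rsum (b := a))//.
- exact: (summable_pos sa).
- exact: (summable_neg sa).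
Qed.

Lemma rsumD a b : abs_summable a -> abs_summable b ->
  rsum D (fun i => a i + b i) = rsum D a + rsum D b.
Proof.
move=> sa sb; rewrite (rsumE sa) (rsumE sb).
have [pa na] := (summable_pos sa, summable_neg sa).
have [pb nb] := (summable_pos sb, summable_neg sb).
rewrite (eq_rsum (b := fun i => (pos a i + pos b i) - (neg a i + neg b i))).
  rewrite rsumB_ge0.
  - rewrite (rsumD_ge0 (@pos_ge0 a) (@pos_ge0 b) pa pb).
    by rewrite (rsumD_ge0 (@neg_ge0 a) (@neg_ge0 b) na nb) opprD addrACA.
  - by move=> i Di; rewrite addr_ge0 ?pos_ge0.
  - by move=> i Di; rewrite addr_ge0 ?neg_ge0.
  - exact: abs_summableD.
  - exact: abs_summableD.
by move=> i _; rewrite {1}(posnegE a) {1}(posnegE b); lra.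
Qed.

Let rsumN a : abs_summable a -> rsum D (fun i => - a i) = - rsum D a.
Proof.
move=> sa; rewrite (rsumE sa).
rewrite (eq_rsum (b := fun i => neg a i - pos a i)).
  rewrite (rsumB_ge0 (@neg_ge0 a) (@pos_ge0 a)) ?opprB//.
  - exact: (summable_neg sa).
  - exact: (summable_pos sa).
by move=> i _; rewrite {1}(posnegE a) opprB.
Qed.

(** A family of nonnegative reals with bounded finite partial sums is
    summable, and the bound holds for its sum. *)
Lemma rsum_le a M : (forall i, D i -> 0 <= a i) ->
    (forall F, finite_set F -> F `<=` D -> \sum_(i \in F) a i <= M) ->
  abs_summable a /\ rsum D a <= M.
Proof.
move=> a0 aM.
have le : (\esum_(i in D) (a i)%:E <= M%:E)%E.
  apply: ge_ereal_sup => _ [X [finX XD] <-].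
  by rewrite fsumEFin// lee_fin aM.
have sa : abs_summable a.
  rewrite /abs_summable /summable.
  rewrite (eq_esum (b := fun i => (a i)%:E)); last first.
    by move=> i Di /=; rewrite ger0_norm ?a0.
  by apply: le_lt_trans le _; rewrite ltry.
by split=> //; rewrite -lee_fin EFin_rsum.
Qed.

Lemma fsum_le_rsum a F : (forall i, D i -> 0 <= a i) -> abs_summable a ->
  finite_set F -> F `<=` D -> \sum_(i \in F) a i <= rsum D a.
Proof.
move=> a0 sa finF FD; rewrite -lee_fin EFin_rsum// -fsumEFin//.
by apply: esum_ge; exists F.
Qed.

Lemma le_rsum_point a i : (forall j, D j -> 0 <= a j) -> abs_summable a ->
  D i -> a i <= rsum D a.
Proof.
move=> a0 sa Di; have := @fsum_le_rsum a [set i] a0 sa (finite_set1 i).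
by rewrite fsbig_set1; apply=> _ ->.
Qed.

Let rsumZ_ge0 k p : 0 <= k -> (forall i, D i -> 0 <= p i) -> abs_summable p ->
  rsum D (fun i => k * p i) <= k * rsum D p.
Proof.
move=> k0 p0 sp; apply: (rsum_le _ _).2 => [i Di|F finF FD].
  by rewrite mulr_ge0 ?p0.
rewrite (_ : \sum_(i \in F) k * p i = k * \sum_(i \in F) p i).
  by rewrite ler_wpM2l// fsum_le_rsum.
by rewrite !fsbig_finite// mulr_sumr.
Qed.

(* The reverse inequality is [rsumZ_ge0] for the factor [k^-1]. *)
Let rsumZ_eq k p : 0 <= k -> (forall i, D i -> 0 <= p i) -> abs_summable p ->
  rsum D (fun i => k * p i) = k * rsum D p.
Proof.
move=> k0 p0 sp; apply/eqP; rewrite eq_le rsumZ_ge0//=.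
have [->|kN0] := eqVneq k 0.
  rewrite mul0r; apply: rsum_ge0 => [i|]; first by rewrite mul0r.
  exact: abs_summableZ.
have k_gt0 : 0 < k by rewrite lt_neqAle eq_sym kN0.
rewrite -ler_pdivlMl//.
rewrite {1}(eq_rsum (a := p) (b := fun i => k^-1 * (k * p i))); last first.
  by move=> i Di; rewrite mulKf.
apply: rsumZ_ge0; first by rewrite invr_ge0.
  by move=> i Di; rewrite mulr_ge0 ?p0.
exact: abs_summableZ.
Qed.

Lemma rsumZ k a : abs_summable a -> rsum D (fun i => k * a i) = k * rsum D a.
Proof.
wlog k0 : k / 0 <= k => [wlog|sa].
  have [k0|k0] := leP 0 k => sa; first exact: wlog.
  rewrite (eq_rsum (b := fun i => - (- k * a i))); last first.
    by move=> i _; rewrite mulNr opprK.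
  rewrite rsumN; last exact: abs_summableZ.
  by rewrite wlog ?oppr_ge0 ?ltW// mulNr opprK.
have [pa na] := (summable_pos sa, summable_neg sa).
rewrite (rsumE sa) (eq_rsum (b := fun i => k * pos a i - k * neg a i)).
  rewrite rsumB_ge0.
  - rewrite (rsumZ_eq k0 (@pos_ge0 a) pa) (rsumZ_eq k0 (@neg_ge0 a) na).
    by rewrite mulrBr.
  - by move=> i Di; rewrite mulr_ge0 ?pos_ge0.
  - by move=> i Di; rewrite mulr_ge0 ?neg_ge0.
  - exact: abs_summableZ.
  - exact: abs_summableZ.
by move=> i _; rewrite -mulrBr -posnegE.
Qed.

Lemma abs_summable_finite a F : finite_set F -> F `<=` D ->
  (forall i, D i -> ~ F i -> a i = 0) -> abs_summable a.
Proof.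
move=> finF FD a0; rewrite /abs_summable /summable.
have -> : (\esum_(i in D) `|(EFin \o a) i| = \esum_(i in F) `|(a i)%:E|)%E.
  rewrite -(setIidr FD) esum_mkcondr; apply: eq_esum => i Di /=.
  by case: ifPn => //; rewrite notin_setE => nFi; rewrite a0// normr0.
by rewrite esum_fset// fsumEFin// ltry.
Qed.

Lemma rsum_finite a F : finite_set F -> F `<=` D ->
  (forall i, D i -> ~ F i -> a i = 0) -> rsum D a = \sum_(i \in F) a i.
Proof.
move=> finF FD a0.
have pE p : (forall i, D i -> 0 <= p i) -> (forall i, D i -> ~ F i -> p i = 0) ->
    rsum D p = \sum_(i \in F) p i.
  move=> p0 pF; apply: EFin_inj.
  rewrite EFin_rsum//; last exact: abs_summable_finite pF.
  rewrite -fsumEFin// -esum_fset//; last first.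
    by move=> i /set_mem Fi; rewrite lee_fin p0//; exact: FD.
  rewrite -(setIidr FD) esum_mkcondr; apply: eq_esum => i Di /=.
  by case: ifPn => //; rewrite notin_setE => nFi; rewrite pF.
rewrite rsumE; last exact: abs_summable_finite a0.
rewrite (pE _ (@pos_ge0 a)) ?(pE _ (@neg_ge0 a)).
- rewrite !fsbig_finite// -sumrB; apply: eq_bigr => i _; exact/esym/posnegE.
- by move=> i Di nF; rewrite /neg a0// normr0 subr0 mul0r.
- by move=> i Di nF; rewrite /pos a0// normr0 addr0 mul0r.
Qed.

End RealSums.

(** * The Dirichlet form on real functions *)
Section DirichletForm.
Variables (R : realType) (V : countType) (G : network R V).
Implicit Types (u v w : V -> R) (e : V * V).

(** Contribution of the oriented edge [e] to the Dirichlet form. *)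
Definition dterm u w e : R :=
  cond G e.1 e.2 * ((u e.1 - u e.2) * (w e.1 - w e.2)).

(** The sum runs over ordered pairs, hence counts every edge twice: for real
    functions it is twice the energy inner product. *)
Definition dform u w : R := rsum (edges G) (dterm u w).

(** The value of [u] at the base point is unconstrained. *)
Definition finite_energy u : Prop := abs_summable (edges G) (dterm u u).

Lemma dterm_ge0 u e : edges G e -> 0 <= dterm u u e.
Proof.
by move=> Ee; rewrite mulr_ge0 ?(ltW (cond_gt0 Ee))// -expr2 sqr_ge0.
Qed.

(** The cross terms are dominated, since [|p q| <= p^2 + q^2]. *)
Lemma finite_energy_cross u w : finite_energy u -> finite_energy w ->
  abs_summable (edges G) (dterm u w).
Proof.
move=> fu fw; apply: le_abs_summable (abs_summableD fu fw) => e Ee.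
have c0 := cond_gt0 Ee; rewrite /dterm -mulrDr normrM gtr0_norm//.
rewrite (ler_wpM2l (ltW c0))// ler_norml.
move: (u e.1 - u e.2) (w e.1 - w e.2) => p q.
have := sqr_ge0 (p + q); have := sqr_ge0 (p - q).
by have := sqr_ge0 p; have := sqr_ge0 q; rewrite !expr2 => *; apply/andP; split; nra.
Qed.

Lemma finite_energyD u w : finite_energy u -> finite_energy w ->
  finite_energy (fun z => u z + w z).
Proof.
move=> fu fw; have sD := abs_summableD fu fw.
apply: le_abs_summable (abs_summableD sD sD) => e Ee.
have c0 := ltW (cond_gt0 Ee).
rewrite ger0_norm ?dterm_ge0// /dterm -!mulrDr ler_wpM2l//.
by have := sqr_ge0 (u e.1 - u e.2 - (w e.1 - w e.2)); rewrite expr2 => *; nra.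
Qed.

Lemma finite_energyZ k u : finite_energy u -> finite_energy (fun z => k * u z).
Proof.
move=> /(abs_summableZ (k ^+ 2)) fu; apply: le_abs_summable fu => e Ee.
rewrite ger0_norm ?dterm_ge0//.
suff -> : dterm (fun z => k * u z) (fun z => k * u z) e = k ^+ 2 * dterm u u e by [].
by rewrite /dterm; ring.
Qed.

Lemma finite_energy0 : finite_energy (fun=> 0).
Proof.
apply: (abs_summable_finite (@finite_set0 _) (@sub0set _ _)) => e _ _.
by rewrite /dterm subrr !mulr0.
Qed.

Lemma dform0l w : dform (fun=> 0) w = 0.
Proof.
rewrite /dform (rsum_finite (@finite_set0 _) (@sub0set _ _)) ?fsbig_set0//.
by move=> e _ _; rewrite /dterm subrr mul0r mulr0.
Qed.

Lemma dformC u w : dform u w = dform w u.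
Proof. by apply: eq_rsum => e _; rewrite /dterm [X in _ * X]mulrC. Qed.

Lemma dform_ge0 u : finite_energy u -> 0 <= dform u u.
Proof. by move=> fu; apply: rsum_ge0 => // e; exact: dterm_ge0. Qed.

Lemma dformDl u v w : finite_energy u -> finite_energy v -> finite_energy w ->
  dform (fun z => u z + v z) w = dform u w + dform v w.
Proof.
move=> fu fv fw.
rewrite /dform -(rsumD (finite_energy_cross fu fw) (finite_energy_cross fv fw)).
by apply: eq_rsum => e _; rewrite /dterm; ring.
Qed.

Lemma dformZl k u w : finite_energy u -> finite_energy w ->
  dform (fun z => k * u z) w = k * dform u w.
Proof.
move=> fu fw; rewrite /dform -(rsumZ k (finite_energy_cross fu fw)).
by apply: eq_rsum => e _; rewrite /dterm; ring.
Qed.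

Lemma dformDZ k u w : finite_energy u -> finite_energy w ->
  dform (fun z => u z + k * w z) (fun z => u z + k * w z) =
  dform u u + 2 * k * dform u w + k ^+ 2 * dform w w.
Proof.
move=> fu fw; have fk := finite_energyZ k fw; have fuk := finite_energyD fu fk.
rewrite dformDl// dformZl// (dformC u) (dformC w) !dformDl// !dformZl//.
by rewrite (dformC w u); ring.
Qed.

(** Evaluation is a bounded functional of the Dirichlet form: along an edge
    [|u a - u b| <= sqrt (dform u u / cond G a b)], and these bounds add up
    along a path from the base point. *)
Lemma dform_bounds_values z : exists2 K : R, 0 <= K & forall u, finite_energy u ->
  `|u z - u (base G)| <= K * Num.sqrt (dform u u).
Proof.
have [->|zN] := eqVneq z (base G).
  by exists 0 => // u _; rewrite subrr normr0 mul0r.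
have [p pP <-] := network_connected zN; elim: p (base G) pP => [|b p IH] a /=.
  by exists 0 => // u _; rewrite subrr normr0 mul0r.
case/andP=> ab /IH [K K0 HK].
have c0 := cond_gt0 ab.
exists (K + (Num.sqrt (cond G a b))^-1).
  by rewrite addr_ge0// invr_ge0 sqrtr_ge0.
move=> u fu; rewrite -(subrK (u b) (u (last b p))) -addrA.
rewrite (le_trans (ler_normD _ _))// mulrDl lerD ?HK// distrC.
have s0 : 0 < Num.sqrt (cond G a b) by rewrite sqrtr_gt0.
rewrite -(ler_pM2l s0) mulrA mulfV ?gt_eqF// mul1r -sqrtr_sqr -sqrtrM ?(ltW c0)//.
apply: ler_wsqrtr; rewrite expr2.
exact: (@le_rsum_point _ _ _ _ (a, b) (@dterm_ge0 u) fu).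
Qed.

(** Lower semicontinuity of the Dirichlet form under pointwise convergence. *)
Lemma dform_lsc (u : nat -> V -> R) v (M : nat -> R) l :
  (forall n, finite_energy (u n)) -> (forall n, dform (u n) (u n) <= M n) ->
  M @ \oo --> l -> (forall z, u ^~ z @ \oo --> v z) ->
  finite_energy v /\ dform v v <= l.
Proof.
move=> fu uM Ml uv; apply: rsum_le => [e|F finF FE]; first exact: dterm_ge0.
have cF : (fun n => \sum_(e \in F) dterm (u n) (u n) e) @ \oo -->
          \sum_(e \in F) dterm v v e.
  under eq_fun do rewrite fsbig_finite//.
  rewrite fsbig_finite//; apply: cvg_big => [|e _]; first exact: add_continuous.
  have d : (fun n => u n e.1 - u n e.2) @ \oo --> v e.1 - v e.2.
    exact: cvgB (uv _) (uv _).
  exact: cvgM (@cvg_cst _ _ _ _ _) (cvgM d d).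
apply: ler_cvg_to cF Ml _; apply: nearW => n.
apply: le_trans (uM n); apply: fsum_le_rsum => //; first exact: dterm_ge0.
exact: fu.
Qed.

(** Riesz representation of the evaluation at [x]: the representative is the
    minimizer of [J u = dform u u - 2 * u x] among the functions of finite
    energy vanishing at the base point. *)
Lemma dform_riesz x : exists v, [/\ v (base G) = 0, finite_energy v &
  forall w, w (base G) = 0 -> finite_energy w -> dform v w = w x].
Proof.
pose H : set (V -> R) := [set u | u (base G) = 0 /\ finite_energy u].
pose J u := dform u u - 2 * u x.
have bH z : exists2 K : R, 0 <= K &
    forall u, H u -> `|u z| <= K * Num.sqrt (dform u u).
  have [K K0 HK] := dform_bounds_values z; exists K => // u [u0 fu].
  by have := HK u fu; rewrite u0 subr0.
have HD u w k : H u -> H w -> H (fun z => u z + k * w z).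
  move=> [u0 fu] [w0 fw]; split; first by rewrite u0 w0 mulr0 addr0.
  exact: finite_energyD fu (finite_energyZ k fw).
pose E := [set J u | u in H]; pose m := inf E.
have H0 : H (fun=> 0) by split=> //; exact: finite_energy0.
have lbE : has_lbound E.
  (* [J u >= s ^+ 2 - 2 * K * s >= - K ^+ 2], where [s ^+ 2 = dform u u]. *)
  have [K K0 HK] := bH x; exists (- K ^+ 2) => _ [u Hu <-].
  have := HK u Hu; have [_ fu] := Hu; have d0 := dform_ge0 fu.
  have := ler_norm (u x); rewrite /J -[X in X - 2 * _](sqr_sqrtr d0).
  move: (Num.sqrt _) => s ux uK.
  by have := sqr_ge0 (s - K); rewrite !expr2 => *; nra.
have infE : has_inf E by split=> //; exists (J (fun=> 0)), (fun=> 0).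
have mJ u : H u -> m <= J u by move=> Hu; apply: ge_inf => //; exists u.
have /choice[u uP] : forall n, exists u, H u /\ J u < m + (harmonic n : R) ^+ 2.
  move=> n; have h0 : 0 < (harmonic n : R) ^+ 2 by rewrite exprn_gt0 ?harmonic_gt0.
  by have [_ [u Hu <-] Ju] := inf_adherent h0 infE; exists u.
have Hu n := (uP n).1; have fu n := (Hu n).2.
(* Parallelogram identity: [dform d d / 2 = J (u n) + J (u k) - 2 * J mid],
   where [d] is the difference and [mid] the midpoint of [u n] and [u k], and
   [J mid >= m]. *)
have uC n k : dform (fun z => u n z + (-1) * u k z) (fun z => u n z + (-1) * u k z)
    <= (2 * (harmonic n + harmonic k)) ^+ 2.
  set d := fun z => u n z + (-1) * u k z; have Hd : H d by exact: HD.
  have unE : u n = (fun z => u k z + 1 * d z).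
    by apply/funext => z; rewrite /d; ring.
  have := mJ _ (HD _ _ 2^-1 (Hu k) Hd); have [_ Jn] := uP n; have [_ Jk] := uP k.
  move: Jn Jk (harmonic_ge0 (R := R) n) (harmonic_ge0 (R := R) k).
  rewrite /J unE !dformDZ//; [|exact: Hd.2..].
  move: (harmonic n) (harmonic k) (dform _ _) (dform _ _) (dform d d) (d x) => a b.
  by move=> *; nra.
have [v uv] : exists v, forall z, u ^~ z @ \oo --> v z.
  suff cu z : cvg (u ^~ z @ \oo) by exists (fun z => lim (u ^~ z @ \oo)).
  have [K K0 HK] := bH z.
  apply/cauchy_cvgP/cauchy_ballP => e e0; near_simpl.
  have d0 : 0 < e / (4 * (K + 1)) by rewrite divr_gt0// mulr_gt0// ltr_wpDl.
  have hd : \forall n \near \oo, harmonic n < e / (4 * (K + 1)).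
    have := cvgr_lt 0 (@cvg_harmonic R); exact.
  near=> n k; rewrite /ball /= -[u k z]mul1r -mulNr.
  have Hd := HD _ _ (-1) (Hu n) (Hu k).
  apply: le_lt_trans (HK _ Hd) _.
  have hs : Num.sqrt (dform (fun z => u n z + (-1) * u k z)
      (fun z => u n z + (-1) * u k z)) <= 2 * (harmonic n + harmonic k).
    rewrite -(@ger0_norm _ (2 * _)); last by rewrite mulr_ge0// addr_ge0 ?harmonic_ge0.
    by rewrite -sqrtr_sqr ler_wsqrtr.
  apply: le_lt_trans (ler_wpM2l K0 hs) _.
  have hn : harmonic n < e / (4 * (K + 1)) by near: n.
  have hk : harmonic k < e / (4 * (K + 1)) by near: k.
  have de : e / (4 * (K + 1)) * (4 * (K + 1)) = e.
    by rewrite divfK// gt_eqF// mulr_gt0// ltr_wpDl.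
  move: hn hk de d0; move: (e / _) (harmonic n) (harmonic k) => d a b.
  by move=> *; nra.
have [fv Jv] : finite_energy v /\ dform v v <= m + 2 * v x.
  apply: (dform_lsc (u := u) (M := fun n => m + harmonic n ^+ 2 + 2 * u n x)) => //.
    by move=> n; have [_] := uP n; rewrite /J; lra.
  apply: cvgD; last exact: cvgM (@cvg_cst _ _ _ _ _) (uv x).
  rewrite -[m in X in _ --> X]addr0; apply: cvgD; first exact: cvg_cst.
  have := cvgM (@cvg_harmonic R) (@cvg_harmonic R); rewrite mulr0; exact.
have v0 : v (base G) = 0.
  have := uv (base G).
  under eq_cvg do rewrite (Hu _).1.
  by move=> /cvg_lim <-//; exact: lim_cst.
exists v; split=> // w w0 fw.
have {}mJ t : m <= J (fun z => v z + t * w z) by apply: mJ; apply: HD.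
(* [J (v + t w) - J v] is nonnegative for all [t]; at [t = - d / (q + 1)], where
   [d] is its linear coefficient halved and [q] its quadratic coefficient, this
   forces [d = 0]. *)
have {}mJ t : 0 <= 2 * t * (dform v w - w x) + t ^+ 2 * dform w w.
  by have := mJ t; rewrite /J dformDZ//; lra.
have := dform_ge0 fw; move: (dform w w) mJ => q mJ q0.
apply/eqP; rewrite -subr_eq0; move: (_ - _) mJ => d mJ.
have := mJ (- d / (q + 1)); have q1 : 0 < q + 1 by lra.
have [//|dN0] := eqVneq d 0.
have d2 : 0 < d ^+ 2 by rewrite exprn_even_gt0.
have -> : 2 * (- d / (q + 1)) * d + (- d / (q + 1)) ^+ 2 * q =
    - (d ^+ 2 * (q + 2) / (q + 1) ^+ 2) by field; rewrite gt_eqF.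
rewrite oppr_ge0 leNgt divr_gt0//; last by rewrite exprn_gt0.
by rewrite mulr_gt0//; lra.
Unshelve. all: by end_near.
Qed.

End DirichletForm.

(** * The energy space and its dipoles *)
Section Energy.
Variables (R : realType) (V : countType) (G : network R V).
Implicit Types (f h : V -> R[i]) (x y z : V).

Let re f : V -> R := fun z => complex.Re (f z).
Let im f : V -> R := fun z => complex.Im (f z).

(** A complex function lies in the energy space iff it vanishes at the base
    point and its real and imaginary parts have finite energy. *)
Lemma energy_spaceP f : energy_space G f <->
  [/\ f (base G) = 0, finite_energy G (re f) & finite_energy G (im f)].
Proof.
pose q (e : V * V) := cond G e.1 e.2 * Normc.normc (f e.1 - f e.2) ^+ 2.
have qE e : q e = dterm G (re f) (re f) e + dterm G (im f) (im f) e.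
  rewrite /q /dterm /re /im; case: (f e.1) (f e.2) => [a b] [c d] /=.
  by rewrite sqr_sqrtr ?addr_ge0 ?sqr_ge0//; ring.
have re0 e : edges G e -> 0 <= dterm G (re f) (re f) e by exact: dterm_ge0.
have im0 e : edges G e -> 0 <= dterm G (im f) (im f) e by exact: dterm_ge0.
have q0 e : edges G e -> 0 <= q e by move=> Ee; rewrite qE addr_ge0 ?re0 ?im0.
have finE : (energy G f < +oo)%E <-> abs_summable (edges G) q.
  rewrite /abs_summable /summable.
  rewrite (eq_esum (b := fun e => (q e)%:E)); last first.
    by move=> e Ee /=; rewrite ger0_norm ?q0.
  rewrite /energy -/(q _); case: (\esum_(e in _) _) => [r| |].
  - by rewrite -EFinM !ltry.
  - by rewrite gt0_muley// lte_fin invr_gt0.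
  - by rewrite gt0_muleNy// lte_fin invr_gt0.
split=> [[f0 /finE fq]|[f0 fre fim]]; last first.
  split=> //; apply/finE; apply: le_abs_summable (abs_summableD fre fim) => e Ee.
  by rewrite ger0_norm ?q0// qE.
split=> //; apply: le_abs_summable fq => e Ee.
  by rewrite ger0_norm ?re0// qE lerDl im0.
by rewrite ger0_norm ?im0// qE lerDr re0.
Qed.

Lemma energy_inner_ReIm h f : energy_space G h -> energy_space G f ->
  energy_inner G h f =
    (2^-1 * (dform G (re h) (re f) + dform G (im h) (im f))) +i*
    (2^-1 * (dform G (re h) (im f) - dform G (im h) (re f))).
Proof.
move=> /energy_spaceP[_ rh ih] /energy_spaceP[_ rf jf].
have mulC k a b : k%:C * (a +i* b) = (k * a) +i* (k * b) :> R[i].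
  by apply/eqP; rewrite eq_complex /=; apply/andP; split; apply/eqP; ring.
have halfE : 2^-1 = (2^-1)%:C :> R[i] by rewrite fmorphV rmorph_nat.
rewrite /energy_inner /csum halfE mulC; congr ((_ * _) +i* (_ * _)).
  rewrite /dform -(rsumD (finite_energy_cross rh rf) (finite_energy_cross ih jf)).
  apply: eq_rsum => e _; rewrite /dterm /re /im.
  by case: (h e.1) (h e.2) (f e.1) (f e.2) => [a b] [c d] [s t] [u v] /=; ring.
rewrite -mulN1r /dform -(rsumZ _ (finite_energy_cross ih rf)).
rewrite -(rsumD (finite_energy_cross rh jf)); last first.
  exact/abs_summableZ/finite_energy_cross.
apply: eq_rsum => e _; rewrite /dterm /re /im.
by case: (h e.1) (h e.2) (f e.1) (f e.2) => [a b] [c d] [s t] [u v] /=; ring.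
Qed.

Lemma energy_innerC h f : energy_space G h -> energy_space G f ->
  energy_inner G f h = (energy_inner G h f)^*.
Proof.
move=> Hh Hf; rewrite !energy_inner_ReIm//=.
rewrite 2!(dformC _ (re f)) 2!(dformC _ (im f)); congr (_ +i* _).
by rewrite -mulrN opprB.
Qed.

(** The dipole is real: it is twice the representative of [dform_riesz], the
    factor 2 compensating the double counting in [dform]. *)
Lemma dipole_exists x : exists v, is_dipole G x v.
Proof.
have [v [v0 fv vw]] := dform_riesz G x.
have re_v : re (fun z => (2 * v z)%:C) = (fun z => 2 * v z) by [].
have fin0 := finite_energy0 G.
have Hv : energy_space G (fun z => (2 * v z)%:C).
  apply/energy_spaceP; split; rewrite ?re_v ?v0 ?mulr0//.
  exact: finite_energyZ.
exists (fun z => (2 * v z)%:C); split=> // f Hf.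
have /energy_spaceP[f0 rf jf] := Hf.
rewrite energy_inner_ReIm// re_v !dformZl//.
rewrite !dform0l addr0 subr0 !vw// /re /im ?f0//= subr0.
by rewrite !mulKf//; case: (f x).
Qed.

Lemma dipoleP x : is_dipole G x (dipole G x).
Proof. exact: (xgetPex _ (dipole_exists x)). Qed.

End Energy.

(** * The Dirichlet form against a Dirac mass *)
Section Delta.
Variables (R : realType) (V : countType) (G : network R V) (x : V).

(* [d] is the real Dirac mass; [out] and [inn] are the edges with origin,
   respectively end, [x], the only ones on which [d] varies. *)
Let d : V -> R := fun y => (y == x)%:R.
Let out : set (V * V) := (fun y => (x, y)) @` neighbors G x.
Let inn : set (V * V) := (fun y => (y, x)) @` neighbors G x.

Let fin_out : finite_set out.
Proof. exact/finite_image/locally_finite. Qed.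
Let fin_inn : finite_set inn.
Proof. exact/finite_image/locally_finite. Qed.

Let sub_star : out `|` inn `<=` edges G.
Proof. by move=> _ [[y xy <-]|[y xy <-]] //; rewrite /edges/= edge_sym. Qed.

Let disj_star : out `&` inn `<=` set0.
Proof.
by move=> _ [[y xy <-] [z xz [zx yx]]]; move: xy; rewrite /neighbors/= -yx edge_irr.
Qed.

Let dterm0 u e : edges G e -> ~ (out `|` inn) e -> dterm G d u e = 0.
Proof.
case: e => a b; rewrite /edges/= => ab nst; rewrite /dterm /d /=.
have [ax|ax] := eqVneq a x.
  by case: nst; left; exists b => //; [rewrite /neighbors/= -ax|rewrite ax].
have [bx|bx] := eqVneq b x.
  by case: nst; right; exists a => //; [rewrite /neighbors/= -bx edge_sym|rewrite bx].
by rewrite subrr mul0r mulr0.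
Qed.

Lemma finite_energy_delta : finite_energy G d.
Proof.
have fs : finite_set (out `|` inn) by rewrite finite_setU.
by apply: (abs_summable_finite fs sub_star) => e; exact: dterm0.
Qed.

(** Each edge at [x] contributes twice, once for each orientation. *)
Lemma dform_delta u :
  dform G d u = 2 * \sum_(y \in neighbors G x) cond G x y * (u x - u y).
Proof.
have fs : finite_set (out `|` inn) by rewrite finite_setU.
rewrite /dform (rsum_finite fs sub_star); last by move=> e; exact: dterm0.
rewrite fsbigU0// !fsbig_image; [|by move=> y z _ _ []..].
rewrite mulr2n mulrDl mul1r; congr (_ + _); apply: eq_fsbigr => y /set_mem xy.
  have yx : (y == x) = false.
    by apply/negP => /eqP yx; move: xy; rewrite /neighbors/= yx edge_irr.
  by rewrite /dterm /d /= eqxx yx subr0 mul1r.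
have yx : (y == x) = false.
  by apply/negP => /eqP yx; move: xy; rewrite /neighbors/= yx edge_irr.
rewrite /dterm /d /= eqxx yx -(cond_sym xy).
by rewrite sub0r mulN1r opprB.
Qed.

End Delta.

(** * Dirac masses in the energy space *)

Theorem corollary4p5 (R : realType) (V : countType) (G : network R V) (x : V)
    (x_neq_base : x != base G) :
  (forall f : V -> R[i], energy_space G f ->
     energy_inner G (delta R x) f = laplacian G f x) /\
  delta R x = (fun z : V => (total_cond G x)%:C * dipole G x z -
     \sum_(y \in neighbors G x) (cond G x y)%:C * dipole G y z).
Proof.
have finN : finite_set (neighbors G x) by exact: locally_finite.
have re_delta : (fun z => complex.Re (delta R x z)) = fun z => (z == x)%:R.
  by apply/funext => z; rewrite /delta; case: eqP.
have im_delta : (fun z => complex.Im (delta R x z)) = fun=> 0.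
  by apply/funext => z; rewrite /delta; case: eqP.
have Hd : energy_space G (delta R x).
  apply/energy_spaceP; split.
  - by rewrite /delta eq_sym (negbTE x_neq_base).
  - by rewrite re_delta; exact: finite_energy_delta.
  - by rewrite im_delta; exact: finite_energy0.
have lap f : energy_space G f -> energy_inner G (delta R x) f = laplacian G f x.
  move=> Hf; rewrite energy_inner_ReIm// re_delta im_delta !dform0l addr0 subr0.
  rewrite !dform_delta !mulKf// /laplacian !fsbig_finite//.
  apply/eqP; rewrite eq_complex /= !raddf_sum /=; apply/andP; split; apply/eqP.
    apply: eq_bigr => y _; case: (f x) (f y) => [a b] [s t] /=; ring.
  apply: eq_bigr => y _; case: (f x) (f y) => [a b] [s t] /=; ring.
split=> //; apply/funext => z.
have [Hv vP] := dipoleP G z.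
(* Reproducing the value of [delta R x] at [z] gives, by Hermitian symmetry,
   the conjugate of the Laplacian of the dipole at [z]. *)
have dz : delta R x z = (laplacian G (dipole G z) x)^*.
  by rewrite -lap// -energy_innerC// vP// [delta R x (base G)]Hd.1 subr0.
have vC y : (dipole G z y)^* = dipole G y z.
  have [Hy yP] := dipoleP G y.
  have := energy_innerC Hy Hv; rewrite yP// vP// Hy.1 Hv.1 !subr0 => ->.
  by [].
rewrite dz /laplacian /total_cond !fsbig_finite// rmorph_sum /=.
rewrite rmorph_sum /= mulr_suml -sumrB; apply: eq_bigr => y _.
rewrite rmorphM rmorphB /= !vC oppr0.
by rewrite mulrBr.
Qed.
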